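(* Under the coordinating contract with wholesale price $w^\delta$ and endogenous renewal probability, the OEM cannot extract the entire surplus from the supplier: the fraction of the net present value of the total supply chain profit captured by the OEM satisfies $$\frac{\tilde{\pi}_m^\delta}{\Pi^\delta}<1.$$
   Context: Parameters: capacity cost $c>0$ per unit, production cost $k\ge 0$ per unit, retail price $r$ with $r-k-c>c$, base demand $b\ge 0$, rate $\lambda>0$ with $\frac1\lambda\ge b$, discount factor $0<\delta<1$. Demand in each product generation is distributed as $b+A$ with $A\sim\mathrm{Exp}(\lambda)$, i.i.d. over generations. The first best capacity is $x^*=b+\frac1\lambda\ln\left(\frac{r-k}{c}\right)$, and the optimal discounted total profit of the centralized supply chain is $$\Pi^{\delta}=\frac{1}{1-\delta}\left((r-k-c)\left(b+\frac{1}{\lambda}\right)-\frac{c}{\lambda}\ln\left(\frac{r-k}{c}\right)\right).$$ In the contract with endogenous renewal probability, the OEM pays a wholesale price per delivered unit and renews the contract for the next generation only if the supplier's capacity $x$ meets the current demand (renewal probability $R(x)=1-e^{-\lambda(x-b)}$ for $x\ge b$, and $0$ otherwise). The wholesale price $$w^\delta = k+\frac{\delta c \left(1+b\lambda+\ln\left(\frac{r-k}{c}\right)\right)+(1-\delta)(r-k)}{1+\delta b\lambda}$$ coordinates the chain, i.e. induces the supplier to choose capacity $x^*$. The OEM earns $\mathbb{E}[(r-w^\delta)\min\{b+A,x^*\}]$ in each generation (irrespective of which supplier it works with), so the net present value of its profit is $$\tilde{\pi}_m^{\delta}=\frac{1}{1-\delta}\,(r-w^\delta)\left(b+\frac{1}{\lambda}\left(1-\frac{c}{r-k}\right)\right).$$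 *)

(* Defs.v *)
From HB Require Import structures.
From mathcomp Require Import all_boot all_order all_algebra.
From mathcomp Require Import all_classical all_reals all_analysis.
From mathcomp Require Import measurable_realfun ring lra.

Set Implicit Arguments.
Unset Strict Implicit.
Unset Printing Implicit Defensive.

Import Order.TTheory GRing.Theory Num.Theory.
Import numFieldNormedType.Exports.

Local Open Scope classical_set_scope.
Local Open Scope ring_scope.

Definition mutually_independent d (T : measurableType d) (R : realType)
    (P : probability T R) (A : nat -> {RV P >-> R}) : Prop :=
  forall (s : seq nat) (B : nat -> set R), uniq s ->
    (forall i, measurable (B i)) ->
  P (\bigcap_(i in [set` s]) (A i @^-1` B i)) =
  (\prod_(i <- s) P (A i @^-1` B i))%E.

Definition iid_exponential d (T : measurableType d) (R : realType)
    (P : probability T R) (A : nat -> {RV P >-> R}) (lambda : R) : Prop :=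
  mutually_independent A /\
  forall t (B : set R), measurable B ->
    distribution P (A t) B = exponential_prob lambda B.

(* Net present value; the first generation (t = 0) is not discounted. *)
Definition npv (R : realType) (delta : R) (u : R^nat) : R :=
  limn (series (fun t => delta ^+ t * u t)).

(* Expected one-generation profit of the integrated chain with capacity x; the
   capacity is bought anew, at unit cost c, in every generation. *)
Definition chain_profit d (T : measurableType d) (R : realType)
    (P : probability T R) (c k r b x : R) (A : T -> R) : R :=
  fine 'E_P[fun w => (r - k) * Num.min (b + A w) x - c * x].

(* No renewal indicator appears: the OEM earns the same margin whichever
   supplier serves the current generation. *)
Definition oem_profit d (T : measurableType d) (R : realType)
    (P : probability T R) (r wp b x : R) (A : T -> R) : R :=
  fine 'E_P[fun w => (r - wp) * Num.min (b + A w) x].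

Definition optimal_chain_npv d (T : measurableType d) (R : realType)
    (P : probability T R) (c k r b delta : R) (A : nat -> T -> R) : R :=
  sup [set npv delta (fun t => chain_profit P c k r b x (A t))
      | x in [set x : R | 0 <= x]].

Definition first_best_capacity (R : realType) (c k r b lambda : R) : R :=
  b + lambda^-1 * ln ((r - k) / c).

Definition wholesale_price (R : realType) (c k r b lambda delta : R) : R :=
  k + (delta * c * (1 + b * lambda + ln ((r - k) / c))
       + (1 - delta) * (r - k)) / (1 + delta * b * lambda).

(* The capacity is the one induced by the contract, i.e. the first best. *)
Definition oem_npv d (T : measurableType d) (R : realType)
    (P : probability T R) (c k r b lambda delta : R) (A : nat -> T -> R) : R :=
  npv delta (fun t =>
    oem_profit P r (wholesale_price c k r b lambda delta) b
      (first_best_capacity c k r b lambda) (A t)).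

(* optimal_chain_npvE and oem_npvE below confirm that the two net present values
   have the expected closed forms. *)
Section exponential_demand.
Context d (T : measurableType d) (R : realType) (P : probability T R).
Variables (lambda : R).
Hypothesis (l0 : 0 < lambda).
Variable (A : {RV P >-> R}).
Hypothesis hA : forall B : set R, measurable B ->
  distribution P A B = exponential_prob lambda B.

Lemma measurable_EFin_exponential_pdf (D : set R) : measurable_fun D (fun x : R => (exponential_pdf lambda x)%:E : \bar R).
Proof.
apply/measurable_EFinP; apply: (@measurable_funS _ _ _ _ setT) => //.
exact: measurable_exponential_pdf.
Qed.

Lemma exponential_ae_ge0 : {ae P, forall w, 0 <= A w}.
Proof.
exists (A @^-1` `]-oo, 0[); split.
- by rewrite -[X in measurable X]setTI; exact: measurable_funP.
- have := hA (measurable_itv `]-oo, (0:R)[); rewrite /distribution /pushforward => ->.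
  rewrite /exponential_prob; apply: integral0_eq => x /=.
  by rewrite in_itv/= => x0; rewrite lt0_exponential_pdf.
- by move=> w /= /negP; rewrite -ltNge in_itv.
Qed.

Lemma exponential_tail s : 0 <= s -> P (A @^-1` `]s, +oo[) = (expR (- lambda * s))%:E.
Proof.
move=> s0.
have [s00|] := eqVneq s 0; last first.
  move=> sn0; have sp : 0 < s by rewrite lt_neqAle eq_sym sn0.
  have h : P (A @^-1` `[0, s]) = (1 - (expR (- lambda * s))%:E)%E.
    by rewrite -(exponential_prob_itv0c _ sp) -hA.
  have n0 : P (A @^-1` `]-oo, 0[) = 0%E.
    have := hA (measurable_itv `]-oo, (0:R)[); rewrite /distribution /pushforward => ->.
    rewrite /exponential_prob; apply: integral0_eq => x /=.
    by rewrite in_itv/= => x0; rewrite lt0_exponential_pdf.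
  have mm (i : interval R) : measurable (A @^-1` [set` i]).
    by rewrite -[X in measurable X]setTI; exact: measurable_funP.
  have le : P (A @^-1` `]-oo, s]) = (1 - (expR (- lambda * s))%:E)%E.
    rewrite -h -[RHS]add0e -n0 -measureU//.
    - congr (P _); apply/seteqP; split => w /=; rewrite !in_itv/=.
        by case: (ltP (A w) 0) => h1 h2; [left|right].
      by case=> [h1|/andP[]//]; exact: (le_trans (ltW h1)).
    - apply/seteqP; split => w //= [] ; rewrite !in_itv/= => h1 /andP[h2 _].
      by move: h1; rewrite ltNge h2.
  rewrite (_ : _ @^-1` _ = ~` (A @^-1` `]-oo, s])).
    rewrite probability_setC// le -[LHS]/((1 - (1 - expR (- lambda * s)))%:E); congr EFin; ring.
  by apply/seteqP; split => w /=; rewrite !in_itv/= andbT ltNge; move/negP.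
have mm (i : interval R) : measurable (A @^-1` [set` i]).
  by rewrite -[X in measurable X]setTI; exact: measurable_funP.
rewrite s00 mulr0 expR0.
have n0 : P (A @^-1` `]-oo, 0]) = 0%E.
  have := hA (measurable_itv `]-oo, (0:R)]); rewrite /distribution /pushforward => ->.
  rewrite /exponential_prob -integral_itv_bndo_bndc; last first.
    by exact: measurable_EFin_exponential_pdf.
  apply: integral0_eq => x /=.
  by rewrite in_itv/= => x0; rewrite lt0_exponential_pdf.
rewrite (_ : _ @^-1` _ = ~` (A @^-1` `]-oo, 0])).
  by rewrite probability_setC// n0 sube0.
by apply/seteqP; split => w /=; rewrite !in_itv/= andbT ltNge; move/negP.
Qed.

Definition capped (y : R) (w : T) := Num.max 0 (Num.min (A w) y).
Lemma measurable_capped y : measurable_fun setT (capped y).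
Proof. by apply: measurable_maxr => //; apply: measurable_minr. Qed.

Lemma integral_capped y : 0 <= y -> (\int[P]_w (capped y w)%:E)%E =
  ((1 - expR (- lambda * y)) / lambda)%:E.
Proof.
move=> y0.
pose X : {RV P >-> R} := HB.pack (capped y) (isMeasurableFun.Build _ _ _ _ _ (measurable_capped y)).
have := @ge0_expectation_ccdf _ _ _ P X.

rewrite unlock => ->; last by move=> w; rewrite /X/= /capped le_max lexx.
have e1 s : 0 <= s -> s < y -> ccdf X s = (expR (- lambda * s))%:E.
  move=> s0 sy; rewrite -exponential_tail//; rewrite /ccdf/= /distribution /pushforward.
  congr (P _); apply/seteqP; split => w /=; rewrite !in_itv/= !andbT /X/= /capped.
    by rewrite lt_max lt_min sy andbT ltNge s0.
  by rewrite lt_max lt_min sy andbT ltNge s0.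
have e2 s : 0 <= s -> y <= s -> ccdf X s = 0%E.
  move=> s0 sy; rewrite /ccdf/= /distribution /pushforward.
  rewrite (_ : _ @^-1` _ = set0) ?measure0//.
  apply/seteqP; split => w //=; rewrite !in_itv/= !andbT /X/= /capped.
  by rewrite lt_max lt_min !ltNge s0 sy andbF.
have [yz|yn0] := eqVneq y 0.
  subst y; rewrite mulr0 expR0 subrr mul0r; apply: integral0_eq => s /=.
  by rewrite in_itv/= andbT => s0; apply: e2.
have yp : 0 < y by rewrite lt_neqAle eq_sym yn0.
transitivity (\int[lebesgue_measure]_(s in `[0%R, y])
   ((lambda^-1)%:E * (exponential_pdf lambda s)%:E))%E; last first.
  rewrite ge0_integralZl//=.
  - have := exponential_prob_itv0c lambda yp; rewrite /exponential_prob => ->.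
    by rewrite -[LHS]/((lambda^-1 * (1 - expR (- lambda * y)))%:E) mulrC.
  - exact: measurable_EFin_exponential_pdf.
  - by move=> s _; rewrite lee_fin exponential_pdf_ge0// ltW.
  - by rewrite lee_fin invr_ge0 ltW.
rewrite -integral_itv_bndo_bndc; last first.
  apply: emeasurable_funM => //.
  exact: measurable_EFin_exponential_pdf.
rewrite integral_mkcond [RHS]integral_mkcond; apply: eq_integral => s _.
rewrite !patchE !mem_setE !in_itv/= andbT.
case: (leP 0 s) => //= s0.
case: (ltP s y) => sy; last by rewrite e2.
rewrite e1// exponential_pdfE// -EFinM; congr EFin.
by rewrite mulrA mulVf ?mul1r// gt_eqF.
Qed.

Lemma integral_min_ge (p q b x : R) : b <= x ->
  (\int[P]_w (p * Num.min (b + A w) x - q)%:E)%E =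
  (p * (b + (1 - expR (- lambda * (x - b))) / lambda) - q)%:E.
Proof.
move=> bx.
have y0 : 0 <= x - b by rewrite subr_ge0.
have bd : P.-integrable setT (EFin \o capped (x - b)).
  apply: measurable_bounded_integrable => //.
  - by rewrite ltey_eq fin_num_measure.
  - exact: measurable_capped.
  - exists (x - b); split => [|M hM w _ /=]; first exact: num_real.
    rewrite ger0_norm; last by rewrite /capped le_max lexx.
    apply/(le_trans _ (ltW hM)); rewrite /capped ge_max y0 ge_min lexx orbT//.
rewrite (@ae_eq_integral _ _ _ P setT (fun w => (p%:E * (capped (x - b) w)%:E + (p * b - q)%:E)%E)) //.
- have h1 := integralZl measurableT bd p.
  have iZ := integrableZl measurableT p bd.
  have iC := @finite_measure_integrable_cst _ _ _ P setT (p * b - q) measurableT.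
  have h2 := integralD measurableT iZ iC.
  rewrite /= in h1 h2; rewrite h2 h1 integral_capped//.
  have -> : (\int[P]_(x in setT) (cst (p * b - q) x)%:E = (p * b - q)%:E)%E.
    by have /= -> := integral_cst P measurableT (p * b - q)%:E; rewrite probability_setT mule1.
  by rewrite -EFinM -EFinD; congr EFin; ring.
- apply/measurable_EFinP/measurable_funB => //; apply: measurable_funM => //.
  apply: measurable_minr => //; exact: measurable_funD.
- apply/measurable_EFinP; apply: measurable_funD => //; apply: measurable_funM => //; exact: measurable_capped.
- apply: filterS exponential_ae_ge0 => w Aw _; rewrite -EFinM -EFinD; congr EFin.
  rewrite /capped; have -> : Num.min (b + A w) x = b + Num.max 0 (Num.min (A w) (x - b)).
    rewrite /Num.min /Num.max.
    have -> : (A w < x - b) = (b + A w < x) by rewrite ltrBrDl.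
    case: ifP => h; case: ifP => h2; lra.
  ring.
Qed.

Lemma integral_min_le (p q b x : R) : x <= b ->
  (\int[P]_w (p * Num.min (b + A w) x - q)%:E)%E = (p * x - q)%:E.
Proof.
move=> bx.
rewrite (@ae_eq_integral _ _ _ P setT (fun w => (p * x - q)%:E)) //.
- by have /= -> := integral_cst P measurableT (p * x - q)%:E; rewrite probability_setT mule1.
- apply/measurable_EFinP/measurable_funB => //; apply: measurable_funM => //.
  apply: measurable_minr => //; exact: measurable_funD.
- apply: filterS exponential_ae_ge0 => w Aw _; congr EFin.
  by rewrite min_r//; lra.
Qed.
End exponential_demand.

Lemma npv_cst (R : realType) (delta v : R) (u : R^nat) : 0 < delta < 1 ->
  (forall t, u t = v) -> npv delta u = v / (1 - delta).
Proof.
move=> /andP[d0 d1] hu; rewrite /npv.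
have -> : (fun t => delta ^+ t * u t) = geometric v delta.
  by apply/funext => t; rewrite hu /geometric/= mulrC.
apply/cvg_lim => //; apply: cvg_geometric_series.
by rewrite ger0_norm// ltW.
Qed.

Section closed_forms.
Context (R : realType) (c k r b lambda delta : R)
    (c_gt0 : 0 < c) (k_ge0 : 0 <= k) (hr : c < r - k - c)
    (b_ge0 : 0 <= b) (lambda_gt0 : 0 < lambda) (hb : b <= 1 / lambda)
    (delta_gt0 : 0 < delta) (delta_lt1 : delta < 1)
    d (T : measurableType d) (P : probability T R)
    (A : nat -> {RV P >-> R}) (hA : iid_exponential A lambda).

Let rho0 : 0 < r - k. Proof. move: c_gt0 hr => h1 h2; lra. Qed.
Let ratio1 : 1 < (r - k) / c. Proof. by rewrite ltr_pdivlMr//; move: c_gt0 hr => h1 h2; lra. Qed.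
Let L0 : 0 < ln ((r - k) / c). Proof. exact: ln_gt0. Qed.

Let xb : b <= first_best_capacity c k r b lambda.
Proof. by rewrite /first_best_capacity lerDl mulr_ge0// ?invr_ge0 ltW. Qed.

Let ex : expR (- lambda * (first_best_capacity c k r b lambda - b)) = c / (r - k).
Proof.
rewrite /first_best_capacity addrAC subrr add0r mulrA mulNr mulfV ?gt_eqF// mulN1r expRN.
by rewrite lnK ?invf_div// posrE (lt_trans _ ratio1).
Qed.

Lemma oem_npvE : oem_npv P c k r b lambda delta A =
  1 / (1 - delta) * ((r - wholesale_price c k r b lambda delta)
    * (b + 1 / lambda * (1 - c / (r - k)))).
Proof.
rewrite /oem_npv (@npv_cst _ _ ((r - wholesale_price c k r b lambda delta)
    * (b + 1 / lambda * (1 - c / (r - k))))) ?delta_gt0//.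
  by rewrite [RHS]mulrC; congr (_ * _); rewrite div1r.
move=> t; rewrite /oem_profit unlock.
under eq_integral do rewrite -[(_ * _)%R]subr0.
by rewrite (integral_min_ge lambda_gt0 (hA.2 t))//= ex subr0 mul1r [X in _ = _ * (_ + X)]mulrC.
Qed.

Lemma optimal_chain_npvE : optimal_chain_npv P c k r b delta A =
  1 / (1 - delta) * ((r - k - c) * (b + 1 / lambda)
    - c / lambda * ln ((r - k) / c)).
Proof.
have H1 := c_gt0; have H2 := hr; have H3 := delta_lt1; have H4 := b_ge0.
have d1 : 0 < 1 - delta by lra.
set V := (X in _ = _ * X).
have up x : b <= x -> npv delta (fun t => chain_profit P c k r b x (A t)) =
    ((r - k) * (b + (1 - expR (- lambda * (x - b))) / lambda) - c * x) / (1 - delta).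
  move=> bx; apply: npv_cst; first by rewrite delta_gt0.
  by move=> t; rewrite /chain_profit unlock (integral_min_ge lambda_gt0 (hA.2 t)).
have lo x : x <= b -> npv delta (fun t => chain_profit P c k r b x (A t)) =
    ((r - k) * x - c * x) / (1 - delta).
  move=> bx; apply: npv_cst; first by rewrite delta_gt0.
  by move=> t; rewrite /chain_profit unlock (integral_min_le (hA.2 t)).
have key x : b <= x -> (r - k) * (b + (1 - expR (- lambda * (x - b))) / lambda) - c * x <= V.
  move=> bx.
  have := expR_ge1Dx (ln ((r - k) / c) - lambda * (x - b)).
  rewrite expRD lnK ?posrE ?(lt_trans _ ratio1)// -mulNr.
  set e := expR _; set L := ln _ => h.
  have h' : c * (1 + (L - lambda * (x - b))) <= (r - k) * e.
    by move: h; rewrite mulrAC ler_pdivlMr// mulrC mulNr.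
  rewrite -(ler_pM2l lambda_gt0).
  have -> : lambda * ((r - k) * (b + (1 - e) / lambda) - c * x) =
    (r - k) * (b * lambda + (1 - e)) - c * x * lambda by field; rewrite gt_eqF.
  have -> : lambda * V = (r - k - c) * (b * lambda + 1) - c * L.
    by rewrite /V -/L; field; rewrite gt_eqF.
  lra.
have VE : npv delta (fun t => chain_profit P c k r b (first_best_capacity c k r b lambda) (A t)) = V / (1 - delta).
  rewrite up// ex; congr (_ / _); rewrite /V /first_best_capacity.
  by field; rewrite !gt_eqF.
rewrite [RHS]mulrC div1r -VE /optimal_chain_npv.
apply/eqP; rewrite eq_le; apply/andP; split.
  apply: ge_sup; first by eexists; exists b => //=.
  move=> _ [x /= x0 <-]; rewrite VE; case: (leP b x) => bx.
    by rewrite up// ler_pM2r ?invr_gt0//; exact: key.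
  rewrite (lo _ (ltW bx)) ler_pM2r ?invr_gt0//; apply: le_trans (key b _) => //.
  rewrite subrr mulr0 expR0 subrr mul0r addr0 -!mulrBl ler_wpM2l//; [lra|exact: ltW].
apply: ub_le_sup.
  exists (V / (1 - delta)) => _ [x /= x0 <-]; case: (leP b x) => bx.
    by rewrite up// ler_pM2r ?invr_gt0//; exact: key.
  rewrite (lo _ (ltW bx)) ler_pM2r ?invr_gt0//; apply: le_trans (key b _) => //.
  rewrite subrr mulr0 expR0 subrr mul0r addr0 -!mulrBl ler_wpM2l//; [lra|exact: ltW].
by exists (first_best_capacity c k r b lambda) => //=; exact: le_trans xb.
Qed.
End closed_forms.

(* Main.v *)
Require Import Defs.
From mathcomp Require Import all_boot all_order all_algebra.
From mathcomp Require Import all_classical all_reals all_analysis.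
From mathcomp Require Import ring lra.

Import Order.TTheory GRing.Theory Num.Theory.

Local Open Scope ring_scope.

(** Both net present values are multiples of one and the same quantity, the
    [scaled_surplus] [S = (r - k - c) (1 + b lambda) - c ln ((r - k) / c)]:
    - the optimal profit of the chain is [S / lambda] in each generation;
    - the OEM's margin at the coordinating price collapses to
      [delta S / (1 + delta b lambda)] (lemma [oem_margin]), and this margin
      multiplies the mean sales [(b lambda + 1 - c / (r - k)) / lambda].

    Since [S > 0], by the strict inequality [ln x < x - 1] at
    [x = (r - k) / c], both [S] and the discount sum [1 / (1 - delta)] cancel,
    and the share of the OEM is exactly
    [delta (b lambda + 1 - c / (r - k)) / (1 + delta b lambda)]
    (lemma [oem_share]). As the contract is renewed with probability
    [q = 1 - c / (r - k)] at the first best capacity, the share left to the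
    supplier is [(1 - delta q) / (1 + delta b lambda)]. It is positive because
    [delta q < 1]: the future, which is what the threat of losing the contract
    bears upon, is discounted and uncertain. *)

Definition scaled_surplus {R : realType} (c k r b lambda : R) : R :=
  (r - k - c) * (1 + b * lambda) - c * ln ((r - k) / c).

Section oem_share.
Context (R : realType) (c k r b lambda : R).
Hypotheses (c_gt0 : 0 < c) (hr : c < r - k).
Hypotheses (b_ge0 : 0 <= b) (lambda_gt0 : 0 < lambda).

Let margin_gt0 : 0 < r - k. Proof. exact: lt_trans hr. Qed.

Let blambda_ge0 : 0 <= b * lambda.
Proof. by rewrite mulr_ge0// ltW. Qed.

Lemma scaled_surplus_gt0 : 0 < scaled_surplus c k r b lambda.
Proof.
have ratio_gt1 : 1 < (r - k) / c by rewrite ltr_pdivlMr// mul1r.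
have L_gt0 : 0 < ln ((r - k) / c) by exact: ln_gt0.
have := expR_gt1Dx (lt0r_neq0 L_gt0).
rewrite lnK ?posrE ?divr_gt0// ltr_pdivlMr// => hL.
have : 0 <= (r - k - c) * (b * lambda) by rewrite mulr_ge0// subr_ge0 ltW.
rewrite /scaled_surplus; lra.
Qed.

(** Over the denominator [1 + delta b lambda], the full margin [r - k] absorbs
    the term [(1 - delta) (r - k)] of the price and leaves
    [delta (r - k) (1 + b lambda)]. The factor [delta] is then common to all
    terms, and what it multiplies is the surplus: the logarithm enters the
    margin only through the profit that it is to be compared with. *)
Lemma oem_margin (delta : R) : 0 <= delta ->
  r - wholesale_price c k r b lambda delta =
  delta * scaled_surplus c k r b lambda / (1 + delta * b * lambda).
Proof.
move=> delta_ge0; rewrite /wholesale_price /scaled_surplus; field.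
by rewrite gt_eqF// -mulrA ltr_pwDl// mulr_ge0.
Qed.

Lemma oem_share (delta : R) (d : measure_display) (T : measurableType d)
    (P : probability T R) (A : nat -> {RV P >-> R}) :
  c < r - k - c -> 0 < delta -> delta < 1 -> iid_exponential A lambda ->
  oem_npv P c k r b lambda delta A / optimal_chain_npv P c k r b delta A =
  delta * (b * lambda + 1 - c / (r - k)) / (1 + delta * b * lambda).
Proof.
move=> hr2 delta_gt0 delta_lt1 hA.
rewrite oem_npvE// (optimal_chain_npvE (lambda := lambda))//.
rewrite oem_margin ?ltW//.
have -> : (r - k - c) * (b + 1 / lambda) - c / lambda * ln ((r - k) / c) =
    scaled_surplus c k r b lambda / lambda.
  by rewrite /scaled_surplus; field; rewrite gt_eqF.
have := scaled_surplus_gt0; set S := scaled_surplus _ _ _ _ _ => S_gt0.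
have discount_gt0 : 0 < 1 - delta by rewrite subr_gt0.
have denom_gt0 : 0 < 1 + delta * b * lambda.
  by rewrite -mulrA ltr_pwDl// mulr_ge0// ltW.
by field; rewrite !gt_eqF.
Qed.

End oem_share.

Theorem proposition9 (R : realType) (c k r b lambda delta : R)
    (c_gt0 : 0 < c) (k_ge0 : 0 <= k) (hr : c < r - k - c)
    (b_ge0 : 0 <= b) (lambda_gt0 : 0 < lambda) (hb : b <= 1 / lambda)
    (delta_gt0 : 0 < delta) (delta_lt1 : delta < 1)
    (d : measure_display) (T : measurableType d) (P : probability T R)
    (A : nat -> {RV P >-> R}) (hA : iid_exponential A lambda) :
  oem_npv P c k r b lambda delta A / optimal_chain_npv P c k r b delta A < 1.
Proof.
have c_lt_margin : c < r - k by lra.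
rewrite oem_share//.
have dbl_ge0 : 0 <= delta * b * lambda by rewrite !mulr_ge0// ltW.
have loss_gt0 : 0 < delta * (c / (r - k)).
  by rewrite mulr_gt0// divr_gt0// (lt_trans c_gt0).
rewrite ltr_pdivrMr; lra.
Qed.
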